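(* Let $u\in\Omega$ be a given and fixed label and $t\ge0$. Then $$\tilde{\mathbb Q}\big(\xi_t=u\,\big|\,\mathcal F_t\big)=\mathbf 1_{(u\in N_t)}\,\frac{e^{-\int_0^t m(X_u(s))R(X_u(s))\,ds}\,\zeta_u(t)}{Z(t)}.$$
   Context: **Branching Markov process.** Let $(J,\mathcal B)$ be a measurable space, $\Xi=(\Xi_t)_{t\ge 0}$ a Markov process in $J$, $R:J\to[0,\infty)$ a measurable function, and for each $x\in J$ let $A(x)$ be a random variable in $\{0,1,2,\dots\}$ with $P(A(x)=k)=p_k(x)$ and finite mean $m(x)=\sum_k k\,p_k(x)$. In the branching Markov process each particle $u$ moves in $J$ as an independent copy of $\Xi$ started from its birth position; if alive at time $t$ at position $X_u(t)$ it dies in $[t,t+dt)$ with probability $R(X_u(t))\,dt+o(dt)$; on dying at location $y$ it is replaced by $1+A_u$ particles positioned at $y$, where $A_u$ is an independent copy of $A(y)$; once born, particles evolve independently. **Marked trees with spines.** Let $\Omega=\{\emptyset\}\cup\bigcup_{n\ge1}\mathbb N^n$, $\mathbb N=\{1,2,\dots\}$, be the set of finite words (labels), with concatenation $uv$; $v<u$ means that $v$ is a strict ancestor of $u$ (i.e. $u=vw$ with $w\ne\emptyset$), and $v\le u$ means $v<u$ or $v=u$. A Galton-Watson tree is a set $\tau\subset\Omega$ with $\emptyset\in\tau$; $uv\in\tau\Rightarrow u\in\tau$; and for each $u\in\tau$ there is $A_u\in\{0,1,2,\dots\}$ with $uj\in\tau\iff 1\le j\le 1+A_u$. A marked tree $(\tau,M)=(\tau,X,\sigma)$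 assigns to each $u\in\tau$ a lifetime $\sigma_u\in\mathbb R^+$ and a path $X_u:[S_u-\sigma_u,S_u)\to J$, where $S_u=\sum_{v\le u}\sigma_v$ is the death (fission) time; at time $S_u$ the particle $u$ has disappeared and its children are alive. The path is extended to $[0,S_u)$ by $X_u(t)=X_v(t)$ for the ancestor $v<u$ with $S_v-\sigma_v\le t<S_v$. $N_t=\{u\in\tau:S_u-\sigma_u\le t<S_u\}$ is the set of particles alive at time $t$. A spine $\xi\in\partial\tau$ is an infinite line of descent $\{\emptyset,u_1,u_2,\dots\}$ in $\tau$. $\tilde{\mathcal T}$ is the set of all $(\tau,M,\xi)$ with $(\tau,M)$ a marked tree and $\xi\in\partial\tau$. There is no explosion: for every $t\ge 0$ each line of descent has exactly one node alive at time $t$; for the spine this node is $\mathrm{node}_t(\xi)$. The symbol $\xi_t$ denotes, according to context, either this node (as in $\{\xi_t=u\}$, $v<\xi_t$) or its spatial position $X_{\mathrm{node}_t(\xi)}(t)\in J$ (as in $R(\xi_s)$). **Filtrations on $\tilde{\mathcal T}$.** $\mathcal F_t=\sigma\big((u,X_u,\sigma_u):S_u\le t;\ (u,X_u(s):s\in[S_u-\sigma_u,t]):t\in[S_u-\sigma_u,S_u)\big)$; $\tilde{\mathcal F}_t=\sigma(\mathcal F_t,\mathrm{node}_t(\xi))$ (the branching process and the spine nodes up to time $t$); $\mathcal G_t=\sigma(\xi_s:0\le s\le t)$ (spatial positions of the spine only). $\mathcal F_\infty,\tilde{\mathcal F}_\infty,\mathcal G_\infty$ are generated by the respective unions over $t$.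 **Measures.** Fix a starting point $x\in J$; superscripts $x$ are suppressed. $P=P^x$ is the probability measure on $(\tilde{\mathcal T},\mathcal F_\infty)$ under which $\mathbb X_t=\{X_u(t):u\in N_t\}$ is the branching Markov process above started from one particle at $x$. Every $\tilde{\mathcal F}_t$-measurable $f$ can be written $f=\sum_{u\in N_t}f_u\mathbf 1_{(\xi_t=u)}$ with each $f_u$ being $\mathcal F_t$-measurable. The probability measure $\tilde P=\tilde P^x$ on $(\tilde{\mathcal T},\tilde{\mathcal F}_\infty)$ is defined by $\int f\,d\tilde P=\int\sum_{u\in N_t}f_u\prod_{v<u}\frac1{1+A_v}\,dP$ for each (nonnegative or bounded) $\tilde{\mathcal F}_t$-measurable $f$. **Martingales.** $\zeta(t)$ is a given strictly positive $\mathcal G_t$-adapted $\tilde P$-martingale, represented as $\zeta(t)=\sum_{u\in N_t}\zeta_u(t)\mathbf 1_{(\xi_t=u)}$ with $\zeta_u(t)$ $\mathcal F_t$-measurable. Define $$Z(t)=\sum_{u\in N_t}e^{-\int_0^t m(X_u(s))R(X_u(s))\,ds}\,\zeta_u(t),\qquad \tilde\zeta(t)=\prod_{v<\xi_t}(1+A_v)\;e^{-\int_0^t m(\xi_s)R(\xi_s)\,ds}\;\zeta(t).$$ The integrals in the exponents are finite, so these processes are strictly positive; $\tilde\zeta$ is an $\tilde{\mathcal F}_t$-adapted $\tilde P$-martingale. **Changed measure.** $\tilde{\mathbb Q}$ is the probability measure on $(\tilde{\mathcal T},\tilde{\mathcal F}_\infty)$ with $\frac{d\tilde{\mathbb Q}}{d\tilde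 P}\big|_{\tilde{\mathcal F}_t}=\tilde\zeta(t)/\tilde\zeta(0)$ for all $t\ge0$. $\tilde{\mathbb Q}(\cdot\mid\mathcal F_t)$ denotes conditional probability/expectation, and equalities hold $\tilde{\mathbb Q}$-almost surely. *)

(* Defs.v *)
From HB Require Import structures.
From mathcomp Require Import all_boot all_order all_algebra.
From mathcomp Require Import all_classical all_reals all_analysis.

Set Implicit Arguments.
Unset Strict Implicit.
Unset Printing Implicit Defensive.

Import Order.TTheory GRing.Theory Num.Theory.
Import numFieldNormedType.Exports.

Local Open Scope classical_set_scope.
Local Open Scope ring_scope.

(* A sub-sigma-algebra of [T] is a [G : set (set T)]. *)
Definition measurable_wrt (T : Type) (d : measure_display)
    (T' : measurableType d) (G : set (set T)) (f : T -> T') : Prop :=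
  forall B : set T', measurable B -> G (f @^-1` B).

Definition natural_filtration (R : realType) (T : Type) (d : measure_display)
    (J : measurableType d) (Y : R -> T -> J) (t : R) : set (set T) :=
  <<s [set E | exists (s : R) (B : set J),
         [/\ 0 <= s <= t, measurable B & E = Y s @^-1` B]] >>.

(* Time is [0, +oo[, embedded in R. *)
Definition martingale (R : realType) (d : measure_display)
    (T : measurableType d) (mu : probability T R) (F : R -> set (set T))
    (M : R -> T -> R) : Prop :=
  [/\ forall t, 0 <= t -> measurable_wrt (F t) (M t),
      forall t, 0 <= t -> mu.-integrable setT (EFin \o M t) &
      forall s t E, 0 <= s <= t -> F s E ->
        (\int[mu]_(w in E) (M t w)%:E = \int[mu]_(w in E) (M s w)%:E)%E].

Definition is_cond_expectation (R : realType) (d : measure_display)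
    (T : measurableType d) (mu : probability T R) (G : set (set T))
    (f g : T -> R) : Prop :=
  [/\ measurable_wrt G g,
      mu.-integrable setT (EFin \o g) &
      forall E, G E ->
        (\int[mu]_(w in E) (g w)%:E = \int[mu]_(w in E) (f w)%:E)%E].

Definition is_cond_probability (R : realType) (d : measure_display)
    (T : measurableType d) (mu : probability T R) (G : set (set T))
    (A : set T) (g : T -> R) : Prop :=
  is_cond_expectation mu G (\1_A : T -> R) g.

(* A time-homogeneous Markov process in the formalism (W, Xi_t, Px): Xi is
   defined on W and [Px y] is the law on W under which Xi starts from y. The
   first clause makes the time integrals of functions of Xi, and the position
   of Xi at a random time, random variables. *)
Definition markov_process (R : realType) (dJ dW : measure_display)
    (J : measurableType dJ) (W : measurableType dW)
    (Px : R.-pker J ~> W) (Xi : W -> R -> J) : Prop :=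
  [/\ measurable_fun ([set: W] `*` `[(0 : R), +oo[%classic)
        (fun p : W * R => Xi p.1 p.2),
      forall (y : J) (B : set J), measurable B ->
        Px y [set w | B (Xi w 0)] = \d_y B &
      forall (y : J) (s t : R) (E : set W) (B : set J),
        0 <= s -> 0 <= t ->
        natural_filtration (fun r w => Xi w r) s E -> measurable B ->
        (Px y (E `&` [set w | B (Xi w (s + t)%R)])
         = \int[Px y]_(w in E) Px (Xi w s) [set w' | B (Xi w' t)])%E].

(* The letter i of a word stands for the positive integer i + 1. *)
Definition label := seq nat.

(* The strict ancestors of u, and those together with u itself. *)
Definition ancestors (u : label) : seq label :=
  [seq take i u | i <- iota 0 (size u)].
Definition lineage (u : label) : seq label :=
  [seq take i u | i <- iota 0 (size u).+1].

(* [offspring], [lifetime] and [particle_path] carry no information at the labels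
   outside [tree], nor does [particle_path] at the times when the particle is not alive.
   [particle_path] is indexed by absolute time. *)
Record marked_tree (R : realType) (J : Type) := MarkedTree {
  tree : set label ;
  offspring : label -> nat ;
  lifetime : label -> R ;
  particle_path : label -> R -> J }.

Section marked_tree_theory.
Context {R : realType} {J : Type}.
Implicit Types (w : marked_tree R J) (u : label) (t : R).

Definition galton_watson w : Prop :=
  [/\ tree w [::],
      forall u v, tree w (u ++ v) -> tree w u &
      forall u, tree w u ->
        forall i, tree w (rcons u i) <-> (i <= offspring w u)%N].

Definition death w u : R := \sum_(v <- lineage u) lifetime w v.
Definition birth w u : R := death w u - lifetime w u.

Definition alive w t : set label :=
  [set u | tree w u /\ birth w u <= t < death w u].

(* The path of u extended to [0, death w u[ by the paths of its ancestors. *)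
Definition extpath w u t : J :=
  particle_path w (xget u [set v | v \in lineage u /\ alive w t v]) t.

Definition line_of_descent (tau xi : set label) : Prop :=
  exists f : nat -> label,
    [/\ f 0%N = [::],
        forall n, exists i, f n.+1 = rcons (f n) i,
        forall n, tau (f n) &
        xi = range f].

Definition no_explosion w : Prop :=
  forall xi, line_of_descent (tree w) xi ->
  forall t, 0 <= t -> exists! u, xi u /\ alive w t u.

End marked_tree_theory.

(* The space of marked trees with spines. The path of each particle is, on its
   lifetime, a trajectory of Xi: on the space of all functions from [0, +oo[ to
   J with the sigma-algebra generated by the coordinates, integrals such as
   those of m(X_u(s))R(X_u(s)) over [0, t] would not be measurable. *)
Record spined_tree (R : realType) (J W : Type) (Xi : W -> R -> J) :=
  SpinedTree {
    mtree :> marked_tree R J ;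
    spine : set label ;
    spined_tree_gw : galton_watson mtree ;
    spined_tree_lifetime : forall u, tree mtree u -> 0 < lifetime mtree u ;
    spined_tree_path : forall u, tree mtree u ->
      exists a : W, forall r, 0 <= r < lifetime mtree u ->
        particle_path mtree u (birth mtree u + r) = Xi a r ;
    spined_tree_spine : line_of_descent (tree mtree) spine ;
    spined_tree_no_explosion : no_explosion mtree }.

(* A [measurableType] must be pointed; the point is the tree with one particle
   per generation and unit lifetimes. *)
Section inhabited.
Context {R : realType} {J W : Type} (Xi : W -> R -> J) (a : W).

Let tau0 : set label := [set u | u = nseq (size u) 0%N].

Let w0 : marked_tree R J :=
  MarkedTree tau0 (fun=> 0%N) (fun=> 1) (fun u t => Xi a (t - (size u)%:R)).

Let death0 u : death w0 u = (size u).+1%:R.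
Proof.
by rewrite /death /lineage big_map -/(index_iota 0 (size u).+1) sumr_const_nat
  subn0.
Qed.

Let birth0 u : birth w0 u = (size u)%:R.
Proof. by rewrite /birth death0 /= -addn1 natrD addrK. Qed.

Let gw0 : galton_watson w0.
Proof.
split=> //= [u v|u tu i].
  rewrite /tau0 /= size_cat nseqD => /eqP.
  by rewrite eqseq_cat ?size_nseq// => /andP[/eqP].
rewrite /tau0 /= size_rcons leqn0 -addn1 nseqD cats1; split.
  by move=> /eqP; rewrite eqseq_rcons => /andP[_].
by move=> /eqP ->; rewrite -tu.
Qed.

Let line0 xi : line_of_descent (tree w0) xi -> xi = tau0.
Proof.
move=> [f [f0 fS tf ->]]; have sf n : size (f n) = n.
  by elim: n => [|n IH]; [rewrite f0|have [i ->] := fS n; rewrite size_rcons IH].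
apply/seteqP; split=> [u [n _ <-]|u tu]; first exact: tf.
by exists (size u) => //; rewrite (tf (size u)) sf; exact/esym.
Qed.

Let noexpl0 : no_explosion w0.
Proof.
move=> xi /line0 -> t t0; exists (nseq (Num.truncn t) 0%N); split.
  split; first by rewrite /tau0 /= size_nseq.
  split; first by rewrite /= /tau0 /= size_nseq.
  rewrite birth0 death0 size_nseq.
  by have := truncn_itv t0.
move=> u [tu [_]]; rewrite birth0 death0 => tn.
by rewrite (truncn_def tn); exact/esym.
Qed.

Definition spined_tree0 : spined_tree Xi.
Proof.
apply: (@SpinedTree R J W Xi w0 tau0 gw0 _ _ _ noexpl0) => [u _ /=|u _|].
- exact: ltr01.
- by exists a => r _; rewrite birth0 /= addrAC subrr add0r.
- exists (fun n => nseq n 0%N); split=> // [n|n|].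
  + by exists 0%N; rewrite -addn1 nseqD cats1.
  + by rewrite /= /tau0 /= size_nseq.
  + apply/seteqP; split=> [u tu|u [n _ <-]]; first by exists (size u).
    by rewrite /tau0 /= size_nseq.
Defined.

End inhabited.

HB.instance Definition _ (R : realType) (J W : Type) (Xi : W -> R -> J) :=
  gen_eqMixin (spined_tree Xi).
HB.instance Definition _ (R : realType) (J W : Type) (Xi : W -> R -> J) :=
  gen_choiceMixin (spined_tree Xi).
HB.instance Definition _ (R : realType) (J : Type) (W : pointedType)
    (Xi : W -> R -> J) :=
  isPointed.Build (spined_tree Xi) (spined_tree0 Xi point).

Section filtrations.
Context {R : realType} {dJ dW : measure_display} {J : measurableType dJ}
  {W : measurableType dW} (Xi : W -> R -> J).
Local Notation T := (spined_tree Xi).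
Implicit Types (t : R) (w : T).

(* [branching_filtration], [spine_filtration], [position_filtration] are
   F_t, Ftilde_t, G_t; [branching_space], [spine_space] carry F_oo, Ftilde_oo. *)

Definition node t w : label := xget [::] (spine w `&` alive w t).
Definition spine_position t w : J := extpath w (node t w) t.

Definition branching_generators t : set (set T) :=
  [set E | exists (u : label) (C : set R), measurable C /\
     E = [set w : T | [/\ tree w u, death w u <= t & C (lifetime w u)]]] `|`
  [set E | exists (u : label) (s : R) (B : set J), measurable B /\
     E = [set w : T | [/\ tree w u, death w u <= t,
                      birth w u <= s < death w u & B (particle_path w u s)]]] `|`
  [set E | exists u : label, E = [set w : T | alive w t u]] `|`
  [set E | exists (u : label) (s : R) (B : set J), measurable B /\
     E = [set w : T | [/\ alive w t u, birth w u <= s <= t & B (particle_path w u s)]]].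

Definition branching_filtration t : set (set T) :=
  <<s branching_generators t >>.

Definition spine_filtration t : set (set T) :=
  <<s branching_filtration t `|`
      [set E | exists u : label, E = [set w : T | node t w = u]] >>.

Definition position_filtration : R -> set (set T) :=
  natural_filtration spine_position.

Definition branching_space : Type := g_sigma_algebraType
  (\bigcup_(t in [set t : R | 0 <= t]) branching_filtration t).
Definition spine_space : Type := g_sigma_algebraType
  (\bigcup_(t in [set t : R | 0 <= t]) spine_filtration t).

HB.instance Definition _ := Measurable.on branching_space.
HB.instance Definition _ := Measurable.on spine_space.

End filtrations.

Section branching.
Context {R : realType} {dJ dW : measure_display} {J : measurableType dJ}
  {W : measurableType dW}.
Variables (Px : R.-pker J ~> W) (Xi : W -> R -> J).
(* [A y] is the law of the random variable A(y): p_k(y) = A y [set k]. *)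
Variables (rate : J -> R) (A : R.-pker J ~> nat).
Local Notation T := (spined_tree Xi).
Local Notation leb := (@lebesgue_measure R).

Definition offspring_mean (y : J) : \bar R :=
  (\sum_(0 <= k <oo) k%:R%:E * A y [set k])%E.

Definition m (y : J) : R := fine (offspring_mean y).

Section construction.
Context {dS : measure_display} {S : measurableType dS}.
(* To every label u, in the tree or not, are attached the random trajectory
   [Xi (traj u)] of u from its birth on, its lifetime and its number of
   children minus one. *)
Variables (rho : probability S R) (x : J).
Variables (traj : label -> S -> W) (life : label -> S -> R)
  (off : label -> S -> nat).

Definition birth_position (u : label) (s : S) : J :=
  if u is [::] then x
  else let v := take (size u).-1 u in Xi (traj v s) (life v s).

(* The information carried by the labels that do not descend from u. *)
Definition history (u : label) : set (set S) :=
  <<s [set E | exists v : label, ~~ prefix u v /\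
        [\/ exists2 B : set W, measurable B & E = traj v @^-1` B,
            exists2 C : set R, measurable C & E = life v @^-1` C |
            exists k : nat, E = off v @^-1` [set k]]] >>.

(* Given the history of u: its trajectory has the law of Xi started from its
   birth position; given also its trajectory, it dies at rate [rate]; given
   also its lifetime, its number of children is 1 + A(y), where y is the
   position at which it dies. *)
Definition branching_family : Prop :=
  [/\ forall u, measurable_fun setT (traj u),
      forall u, measurable_fun setT (life u),
      forall u, measurable_fun setT (off u) &
      forall (u : label) (E : set S), history u E ->
      forall B : set W, measurable B ->
      [/\ (rho (E `&` traj u @^-1` B)
           = \int[rho]_(s in E) Px (birth_position u s) B)%E,
          forall r : R, 0 <= r ->
          (rho (E `&` traj u @^-1` B `&` [set s | (r < life u s)%R])
           = \int[rho]_(s in E `&` traj u @^-1` B)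
               expeR (- \int[leb]_(q in `[0%R, r])
                          (rate (Xi (traj u s) q))%:E))%E &
          forall (C : set R) (k : nat), measurable C ->
          (rho (E `&` traj u @^-1` B `&` life u @^-1` C
                  `&` off u @^-1` [set k])
           = \int[rho]_(s in E `&` traj u @^-1` B `&` life u @^-1` C)
               A (Xi (traj u s) (life u s)) [set k])%E]].

Definition family_tree (s : S) : set label :=
  [set u | forall i, (i < size u)%N -> (nth 0 u i <= off (take i u) s)%N].

Definition represents (s : S) (w : T) : Prop :=
  tree w = family_tree s /\
  forall u, tree w u ->
    [/\ offspring w u = off u s, lifetime w u = life u s &
        forall t, birth w u <= t < death w u ->
          particle_path w u t = Xi (traj u s) (t - birth w u)].

End construction.

(* P is the law, on (T, F_oo), of the marked tree of the branching Markov
   process started from one particle at x. *)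
Definition branching_markov_law (x : J)
    (P : probability (branching_space Xi) R) : Prop :=
  exists (dS : measure_display) (S : measurableType dS)
    (rho : probability S R) (traj : label -> S -> W) (life : label -> S -> R)
    (off : label -> S -> nat) (Phi : S -> branching_space Xi),
  [/\ branching_family rho x traj life off,
      {ae rho, forall s, represents traj life off s (Phi s)},
      measurable_fun setT Phi &
      forall E, measurable E -> P E = rho (Phi @^-1` E)].

Implicit Types (P : probability (branching_space Xi) R)
  (Pt Q : probability (spine_space Xi) R) (t : R) (w : T).

(* [\sum_(u \in alive w t)] ranges over a finite set, as there is no explosion
   and every particle has finitely many children. *)
Definition spine_representation t (f : T -> R) (f_ : label -> T -> R) : Prop :=
  (forall u, measurable_wrt (branching_filtration (Xi := Xi) t) (f_ u)) /\
  forall w, f w = \sum_(u \in alive w t) f_ u w * (node t w == u)%:R.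

Definition spine_measure P Pt : Prop :=
  forall t (f : T -> R) (f_ : label -> T -> R), 0 <= t ->
    measurable_wrt (spine_filtration t) f ->
    (forall w, 0 <= f w) \/ (exists c, forall w, `|f w| <= c) ->
    spine_representation t f f_ ->
    (\int[Pt]_w (f w)%:E
     = \int[P]_w (\sum_(u \in alive w t)
         f_ u w * \prod_(v <- ancestors u) (1 + offspring w v)%:R^-1)%R%:E)%E.

Definition discount t (u : label) w : R :=
  expR (- \int[leb]_(s in `[0, t])
            (m (extpath w u s) * rate (extpath w u s))).

Definition Z (zeta_ : label -> R -> T -> R) t w : R :=
  \sum_(u \in alive w t) discount t u w * zeta_ u t w.

Definition zeta_tilde (zeta : R -> T -> R) t w : R :=
  (\prod_(v <- ancestors (node t w)) (1 + offspring w v)%:R)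
  * expR (- \int[leb]_(s in `[0, t])
              (m (spine_position s w) * rate (spine_position s w)))
  * zeta t w.

Definition changed_measure Pt Q (zt : R -> T -> R) : Prop :=
  forall t (E : set T), 0 <= t -> spine_filtration t E ->
    (Q E = \int[Pt]_(w in E) (zt t w / zt 0 w)%R%:E)%E.

End branching.

(* Main.v *)
Require Import Defs.
From HB Require Import structures.
From mathcomp Require Import all_boot all_order all_algebra.
From mathcomp Require Import all_classical all_reals all_analysis.
From mathcomp Require Import measurable_realfun.

Set Implicit Arguments.
Unset Strict Implicit.
Unset Printing Implicit Defensive.

Import Order.TTheory GRing.Theory Num.Theory.
Import numFieldNormedType.Exports.

Local Open Scope classical_set_scope.
Local Open Scope ring_scope.

(* On Ftilde_t, Q has density zeta_tilde(t) / zeta(0) with respect to Ptilde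
   (zeta_tilde(0) = zeta(0)), and zeta_tilde(t) carries the factor
   prod (1 + A_v) which the definition of Ptilde from P divides out.
   Hence E_Q[f] = E_P[sum_(v in N_t) f_v e^(- int m R) zeta_v(t) / zeta(0)] for
   f = sum_(v in N_t) f_v 1_(xi_t = v). For f = 1_E 1_(xi_t = u) the sum reduces
   to its term u, and for f = 1_E times the right-hand side of the theorem the
   sum is Z(t) times that quotient: the two expectations coincide. *)

(** * Labels: ancestors as prefixes *)

Lemma lineage_rcons u i : lineage (rcons u i) = rcons (lineage u) (rcons u i).
Proof.
rewrite /lineage size_rcons -addn1 iotaD map_cat add0n cats1.
rewrite [take _.+1 _]take_oversize ?size_rcons//; congr (rcons _ _).
apply/eq_in_map => k; rewrite mem_iota add0n ltnS => /andP[_ kn].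
by rewrite -cats1 take_cat; case: ltngtP kn => // -> _;
  rewrite subnn take0 cats0 take_size.
Qed.

Lemma ancestors_rcons u i : ancestors (rcons u i) = lineage u.
Proof.
rewrite /ancestors size_rcons; apply/eq_in_map => k.
rewrite mem_iota add0n ltnS => /andP[_ kn].
by rewrite -cats1 take_cat; case: ltngtP kn => // -> _;
  rewrite subnn take0 cats0 take_size.
Qed.

Lemma mem_lineage u v : (v \in lineage u) = prefix v u.
Proof.
apply/mapP/idP => [[k _ ->]|]; first exact: prefix_take.
move=> vu; exists (size v); last by move: vu; rewrite prefixE => /eqP.
by rewrite mem_iota ltnS size_prefix.
Qed.

Lemma mem_ancestors u v : (v \in ancestors u) = prefix v u && (v != u).
Proof.
apply/mapP/andP => [[k]|[vu nvu]].
  rewrite mem_iota add0n => /andP[_ ku] ->; split; first exact: prefix_take.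
  by apply: contraTneq ku => e; rewrite -leqNgt -{1}e size_take_min geq_minl.
have tu : take (size v) u = v by move: vu; rewrite prefixE => /eqP.
exists (size v) => //; rewrite mem_iota add0n/= ltn_neqAle size_prefix// andbT.
by apply: contra_neq nvu => vs; rewrite -tu vs take_size.
Qed.

(** * Genealogy: spines, spine nodes and the finiteness of the population *)

Section genealogy.
Context {R : realType} {dJ dW : measure_display} {J : measurableType dJ}
  {W : measurableType dW} {Xi : W -> R -> J}.
Local Notation T := (spined_tree Xi).
Implicit Types (w : T) (u v : label) (s t : R).

Lemma death_rcons (w : marked_tree R J) u i :
  death w (rcons u i) = death w u + lifetime w (rcons u i).
Proof. by rewrite /death lineage_rcons -cats1 big_cat big_seq1. Qed.

Lemma birth_rcons (w : marked_tree R J) u i : birth w (rcons u i) = death w u.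
Proof. by rewrite /birth death_rcons addrK. Qed.

Lemma birth_nil (w : marked_tree R J) : birth w [::] = 0.
Proof. by rewrite /birth /death /lineage /= big_seq1 subrr. Qed.

Lemma tree_prefix w u v : prefix v u -> tree w u -> tree w v.
Proof.
by case/prefixP => v' ->; have [_ + _] := spined_tree_gw w; apply.
Qed.

Lemma death_homo w u v : prefix u v -> tree w v -> death w u <= death w v.
Proof.
case/prefixP => v' ->; elim/last_ind: v' => [|v' i IH]; first by rewrite cats0.
rewrite -rcons_cat => tv.
have tv' : tree w (u ++ v') by apply: tree_prefix tv; rewrite prefix_rcons.
rewrite (le_trans (IH tv'))// death_rcons lerDl ltW//.
exact: spined_tree_lifetime.
Qed.

(** The parent of [v] dies at the birth of [v], and death times do not decrease from [u] down to
    that parent because lifetimes are positive. *)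
Lemma death_le_birth w u v :
  u \in ancestors v -> tree w v -> death w u <= birth w v.
Proof.
case/lastP: v => // v i.
rewrite ancestors_rcons mem_lineage birth_rcons => uv tv.
by apply: death_homo => //; apply: tree_prefix tv; rewrite prefix_rcons.
Qed.

(** Indexes the line by length: the node of length [n] is the prefix of all later ones, so
    membership and comparison on the line reduce to [take]. *)
Lemma line_of_descentP (tau xi : set label) : line_of_descent tau xi ->
  exists f : nat -> label, [/\ forall n, size (f n) = n,
    forall n k, (n <= k)%N -> take n (f k) = f n,
    forall n, tau (f n) & xi = range f].
Proof.
move=> [f [f0 fS tf ->]]; exists f.
have sf n : size (f n) = n.
  by elim: n => [|n IH]; [rewrite f0|have [i ->] := fS n; rewrite size_rcons IH].
split=> // n; elim=> [|k IH]; first by rewrite leqn0 => /eqP ->; rewrite f0.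
rewrite leq_eqVlt => /predU1P[->|]; first by rewrite take_oversize// sf.
rewrite ltnS => nk; have [i ->] := fS k.
rewrite -cats1 takel_cat ?sf//; exact: IH.
Qed.

Lemma spine_prefix w u v : spine w u -> prefix v u -> spine w v.
Proof.
have [f [sf tf _ ->]] := line_of_descentP (spined_tree_spine w).
move=> [n _ <-]; rewrite prefixE => vu; exists (size v) => //.
rewrite -(tf _ n); first exact/eqP.
by move/eqP: vu => <-; rewrite size_take_min sf geq_minr.
Qed.

Lemma spine_chain w u v : spine w u -> spine w v ->
  (size v <= size u)%N -> prefix v u.
Proof.
have [f [sf tf _ ->]] := line_of_descentP (spined_tree_spine w).
by move=> [n _ <-] [k _ <-]; rewrite !sf prefixE sf => kn; rewrite tf.
Qed.

Lemma spine_node w t : 0 <= t -> spine w (node t w).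
Proof.
move=> t0.
have [u [[xu au] _]] := spined_tree_no_explosion (spined_tree_spine w) t0.
by have [] := @xgetPex _ [::] (spine w `&` alive w t) (ex_intro _ u (conj xu au)).
Qed.

Lemma alive_node w t : 0 <= t -> alive w t (node t w).
Proof.
move=> t0.
have [u [[xu au] _]] := spined_tree_no_explosion (spined_tree_spine w) t0.
by have [] := @xgetPex _ [::] (spine w `&` alive w t) (ex_intro _ u (conj xu au)).
Qed.

Lemma node_eq w t u : 0 <= t -> spine w u -> alive w t u -> node t w = u.
Proof.
move=> t0 xu au.
have [v [_ uv]] := spined_tree_no_explosion (spined_tree_spine w) t0.
rewrite -(uv u)//; apply/esym/uv; split; [exact: spine_node|exact: alive_node].
Qed.

(** Two spine nodes are comparable. Were the node at [t] a strict ancestor of the node at [s], it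
    would be dead once the latter is born, hence by time [s], yet it is alive at [t >= s]. *)
Lemma node_prefix w s t : 0 <= s <= t -> prefix (node s w) (node t w).
Proof.
move=> /andP[s0 st]; have t0 := le_trans s0 st.
have [xs xt] := (spine_node w s0, spine_node w t0).
have [|ts] := leqP (size (node s w)) (size (node t w)); first exact: spine_chain xt xs.
have [trs /andP[bs _]] := alive_node w s0.
have [_ /andP[_ dt]] := alive_node w t0.
have : death w (node t w) <= birth w (node s w).
  apply: death_le_birth => //; rewrite mem_ancestors (spine_chain xs xt)//= 1?ltnW//.
  by apply: contraTneq ts => ->; rewrite ltnn.
by move=> /le_trans/(_ bs)/le_lt_trans => /(_ _ (le_lt_trans st dt)); rewrite ltxx.
Qed.

(** Prefixes of a spine node are on the spine, and by no explosion only one of them is alive at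
    [s]. *)
Lemma extpath_node w s t : 0 <= s <= t ->
  extpath w (node t w) s = particle_path w (node s w) s.
Proof.
move=> /andP[s0 st]; rewrite /extpath; congr (particle_path w _ s).
apply: xget_unique => [|v].
  by rewrite /= mem_lineage node_prefix ?s0//; split => //; exact: alive_node.
rewrite /= mem_lineage => -[vu av]; apply/esym/node_eq => //.
by apply: spine_prefix vu; exact: spine_node (le_trans s0 st).
Qed.

(* The sigma-algebra of the branching process does not see the spine, which
   can therefore be rerouted through any given particle. *)
Lemma reroute_spine w t u : 0 <= t -> alive w t u ->
  exists2 w' : T, mtree w' = mtree w & node t w' = u.
Proof.
(* The new line goes down to [u] and then always takes the first child (letter 0), which exists
   since a particle has at least one child. *)
move=> t0 au; pose f n := if (n <= size u)%N then take n u
                          else u ++ nseq (n - size u) 0%N.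
have f_child n : exists i, f n.+1 = rcons (f n) i.
  rewrite /f; have [nu|un|->] := ltngtP n (size u).
  - by exists (nth 0%N u n); rewrite (take_nth 0%N).
  - exists 0%N; rewrite subSn; last exact: ltnW.
    by rewrite -[in LHS]addn1 nseqD cats1 rcons_cat.
  - by exists 0%N; rewrite subSnn take_size cats1.
have f_tree n : tree w (f n).
  rewrite /f; case: ifP => _.
    by case: au => + _; apply: tree_prefix; exact: prefix_take.
  elim: (n - size u)%N => [|k IH]; first by rewrite cats0; case: au.
  rewrite -addn1 nseqD cats1 -rcons_cat.
  by have [_ _ /(_ _ IH 0%N)[_ +]] := spined_tree_gw w; apply.
have lf : line_of_descent (tree w) (range f).
  by exists f; split=> //; rewrite /f take0.
exists (SpinedTree (spined_tree_gw w) (@spined_tree_lifetime _ _ _ _ w)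
  (@spined_tree_path _ _ _ _ w) lf (@spined_tree_no_explosion _ _ _ _ w)) => //.
by apply: node_eq => //; exists (size u) => //; rewrite /f leqnn take_size.
Qed.

(* Koenig's lemma: an infinite population would leave an infinite line of
   descent none of whose particles is alive at time t. *)
Lemma finite_alive w t : 0 <= t -> finite_set (alive w t).
Proof.
move=> t0; pose D u := alive w t `&` [set v | prefix u v].
apply: contrapT => inf.
(* Pigeonhole: apart from [u] itself, [D u] splits among the finitely many children of [u]. *)
have child u : infinite_set (D u) -> exists i, infinite_set (D (rcons u i)).
  move=> infu; apply: contrapT => /forallNP fin; apply: infu.
  apply: (@sub_finite_set _ _ ([set u] `|`
      \bigcup_(i in `I_(offspring w u).+1) D (rcons u i))); last first.
    rewrite finite_setU; split; first exact: finite_set1.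
    by apply: bigcup_finite => [|i _]; [exact: finite_II|exact: contrapT (fin i)].
  move=> v [[tv av] /prefixP[[|i v']]]; first by rewrite cats0 => ->; left.
  move=> ev; right; have uiv : prefix (rcons u i) v.
    by rewrite ev -cat_rcons; exact: prefix_prefix.
  have tui := tree_prefix uiv tv; exists i => //=.
  have tu : tree w u by apply: tree_prefix tui; rewrite prefix_rcons.
  by have [_ _ /(_ _ tu i)[+ _]] := spined_tree_gw w; rewrite ltnS; apply.
have /choice[g gP] : forall u, exists i, infinite_set (D u) ->
    infinite_set (D (rcons u i)).
  move=> u; have [/child[i Di]|fin] := pselect (infinite_set (D u)).
    by exists i.
  by exists 0%N.
pose f := fix f n := if n is k.+1 then rcons (f k) (g (f k)) else [::].
have Df n : infinite_set (D (f n)).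
  elim: n => [|n IH]; last exact: gP.
  by apply: contra_not inf; apply: sub_finite_set => v av; split=> //=;
    rewrite prefix0s.
have lf : line_of_descent (tree w) (range f).
  exists f; split=> // [n|n]; first by exists (g (f n)).
  have /set0P[v [[tv _] fv]] : D (f n) != set0.
    by apply/eqP => D0; apply: (Df n); rewrite D0.
  exact: tree_prefix tv.
(* No explosion puts some [f n] alive at [t] on the line; its strict descendants are not born before
   its death, so [D (f n)] has at most one element. *)
have [u [[[n _ <-] [_ /andP[_ dt]]] _]] :=
  spined_tree_no_explosion lf t0.
apply: (Df n); apply: (@sub_finite_set _ _ [set f n]) => [v|]; last first.
  exact: finite_set1.
move=> [[tv /andP[bv _]] fv]; apply: contrapT => /eqP vf.
have : death w (f n) <= birth w v.
  by apply: death_le_birth => //; rewrite mem_ancestors fv eq_sym.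
by move=> /le_trans/(_ bv)/(lt_le_trans dt); rewrite ltxx.
Qed.

Lemma death_nil (w : marked_tree R J) : death w [::] = lifetime w [::].
Proof. by rewrite /death /lineage /= big_seq1. Qed.

Lemma alive0 w u : alive w 0 u <-> u = [::].
Proof.
have tnil : tree w [::] by have [] := spined_tree_gw w.
have dnil : 0 < death w [::] by rewrite death_nil; exact: spined_tree_lifetime.
split=> [[tu /andP[bu _]]|->]; last by split=> //; rewrite birth_nil lexx.
apply: contraTP bu => /eqP u0; rewrite -ltNge (lt_le_trans dnil)//.
by apply: death_le_birth => //; rewrite mem_ancestors prefix0s eq_sym.
Qed.

End genealogy.

(** * Measurability relative to a sub-sigma-algebra *)

(** Passes to measurability on a type carrying the sub-sigma-algebra, where sums, products and
    compositions are available. *)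
Lemma measurable_wrtP (T : pointedType) (d : measure_display)
    (T' : measurableType d) (G : set (set T)) (f : T -> T') :
  measurable_wrt <<s G >> f <->
  measurable_fun setT (f : g_sigma_algebraType G -> T').
Proof.
split=> [mf _ B mB|mf B mB]; first by rewrite setTI; exact: mf.
by rewrite -[_ @^-1` _]setTI; exact: mf.
Qed.

(** Where [f] is positive its inverse is [expR (- ln f)], a composition of measurable functions. *)
Lemma measurable_funV_gt0 (R : realType) (d : measure_display)
    (T : measurableType d) (D : set T) (f : T -> R) :
  (forall x, D x -> 0 < f x) -> measurable_fun D f ->
  measurable_fun D (fun x => (f x)^-1).
Proof.
move=> f0 mf; apply: (eq_measurable_fun (fun x => expR (- ln (f x)))).
  by move=> x /set_mem Dx; rewrite expRN lnK// posrE f0.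
apply: measurableT_comp; first exact: measurable_expR.
apply: measurableT_comp; first exact: oppr_measurable.
by apply: measurableT_comp => //; exact: measurable_ln.
Qed.

(** * Densities and conditional expectations *)

Section density.
Local Open Scope ereal_scope.
Import HBNNSimple.

(** On indicators this is the definition of a density; linearity extends it to simple functions, and
    monotone convergence on both sides to [f]. *)
Lemma ge0_integral_density (R : realType) (d : measure_display)
    (T : measurableType d) (mu nu : {measure set T -> \bar R})
    (D f : T -> R) :
  (forall x, 0 <= D x)%R -> measurable_fun setT D ->
  (forall E, measurable E -> nu E = \int[mu]_(x in E) (D x)%:E) ->
  (forall x, 0 <= f x)%R -> measurable_fun setT f ->
  \int[nu]_x (f x)%:E = \int[mu]_x (f x * D x)%:E.
Proof.
move=> D0 mD nuE f0 mf; have mEf := (measurable_EFinP _ _).2 mf.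
pose h := nnsfun_approx measurableT mEf.
have h_cvg x : ((h n x)%:E @[n --> \oo] --> (f x)%:E)%classic.
  by apply: cvg_nnsfun_approx => // y _; rewrite lee_fin.
have h_homo x : {homo (fun n => h n x) : a b / (a <= b)%N >-> (a <= b)%R}.
  by move=> a b ab; exact/lefP/nd_nnsfun_approx.
have -> : \int[nu]_x (f x)%:E = limn (fun n => \int[nu]_x (h n x)%:E).
  rewrite -monotone_convergence//.
  - by apply: eq_integral => x _; apply/esym/cvg_lim => //; exact: h_cvg.
  - by move=> n; exact/measurable_EFinP.
  - by move=> n x _; rewrite lee_fin.
  - by move=> x _ a b ab; rewrite lee_fin h_homo.
have -> : \int[mu]_x (f x * D x)%:E = limn (fun n => \int[mu]_x (h n x * D x)%:E).
  rewrite -monotone_convergence//.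
  - apply: eq_integral => x _; apply/esym/cvg_lim => //.
    under eq_fun do rewrite EFinM; rewrite EFinM.
    by apply: cvgeZr => //; exact: h_cvg.
  - by move=> n; apply/measurable_EFinP; exact: measurable_funM.
  - by move=> n x _; rewrite lee_fin mulr_ge0.
  - by move=> x _ a b ab; rewrite lee_fin ler_wpM2r// h_homo.
suff hn n : \int[nu]_x (h n x)%:E = \int[mu]_x (h n x * D x)%:E.
  by under eq_fun do rewrite hn.
have mhr r : measurable (h n @^-1` [set r]) by exact: measurable_sfunP.
(* A simple function is the sum of its values times the indicators of its level sets; the integrals
   are compared level by level. *)
transitivity (\int[nu]_x (\sum_(r \in range (h n))
    (r * \1_(h n @^-1` [set r]) x)%:E)).
  by apply: eq_integral => x _; rewrite fsumEFin// -fimfunE.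
transitivity (\int[mu]_x (\sum_(r \in range (h n))
    (r * \1_(h n @^-1` [set r]) x * D x)%:E)); last first.
  apply: eq_integral => x _; rewrite fsumEFin//; congr (_%:E).
  by rewrite -mulr_fsuml -fimfunE.
have h0 r x : 0 <= (r * \1_(h n @^-1` [set r]) x)%:E.
  by have := nnfun_muleindic_ge0 (h n) r x; rewrite -EFinM.
have mh r : measurable_fun setT (fun x => r * \1_(h n @^-1` [set r]) x)%R.
  by apply: measurable_funM => //; exact: measurable_indic.
rewrite ge0_integral_fsum//; last by move=> r; exact/measurable_EFinP.
rewrite ge0_integral_fsum//; last 2 first.
- by move=> r; apply/measurable_EFinP; exact: measurable_funM.
- by move=> r x _; rewrite EFinM mule_ge0// lee_fin.
apply: eq_fsbigr => r /set_mem[y _ <-{r}]; set E := h n @^-1` _.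
have mE : measurable E by exact: mhr.
under eq_integral do rewrite EFinM.
rewrite ge0_integralZl_EFin//; last first.
  by apply/measurable_EFinP; exact: measurable_indic.
rewrite integral_indic// setIT nuE// integral_mkcond.
rewrite -ge0_integralZl_EFin//; last first.
- apply/(measurable_restrictT _ mE).1; apply: measurable_funTS.
  exact/measurable_EFinP.
- by move=> x _; rewrite patchE; case: ifP => // _; rewrite lee_fin.
apply: eq_integral => x _; rewrite patchE indicE.
by case: (x \in E); rewrite ?mulr1 ?mulr0 ?mul0r ?mule0// -EFinM.
Qed.

(* The trace of mu on a sub-sigma-algebra is its image under the identity. *)
Lemma ge0_integral_density_wrt (R : realType) (d : measure_display)
    (T : measurableType d) (mu nu : {measure set T -> \bar R})
    (G : set (set T)) (D f : T -> R) :
  <<s G >> `<=` measurable ->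
  (forall x, 0 <= D x)%R -> measurable_wrt <<s G >> D ->
  (forall E, <<s G >> E -> nu E = \int[mu]_(x in E) (D x)%:E) ->
  (forall x, 0 <= f x)%R -> measurable_wrt <<s G >> f ->
  \int[nu]_x (f x)%:E = \int[mu]_x (f x * D x)%:E.
Proof.
move=> subG D0 /measurable_wrtP mD nuE f0 /measurable_wrtP mf.
pose i (x : T) : g_sigma_algebraType G := x.
have mi : measurable_fun setT i by move=> _ E mE; rewrite setTI; exact: subG.
have mEf := (measurable_EFinP _ _).2 mf.
have mEfD := (measurable_EFinP _ _).2 (measurable_funM mf mD).
have -> : \int[nu]_x (f x)%:E = \int[pushforward nu i]_x (f x)%:E.
  by rewrite [RHS]ge0_integral_pushforward// => x _; rewrite lee_fin.
have -> : \int[mu]_x (f x * D x)%:E = \int[pushforward mu i]_x (f x * D x)%:E.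
  by rewrite [RHS]ge0_integral_pushforward// => x _; rewrite lee_fin mulr_ge0.
apply: ge0_integral_density => // E mE.
rewrite [RHS]ge0_integral_pushforward//=; first exact: nuE.
  by apply: measurable_funTS; exact/measurable_EFinP.
by move=> x _; rewrite lee_fin.
Qed.

End density.

(** Both versions have the same integral over every set of the sub-sigma-algebra, so they agree
    outside a null set of the trace of [mu] on it, which is also null for [mu]. *)
Lemma cond_expectation_unique (R : realType) (d : measure_display)
    (T : measurableType d) (mu : probability T R) (G : set (set T))
    (f g h : T -> R) :
  <<s G >> `<=` measurable ->
  is_cond_expectation mu <<s G >> f g -> is_cond_expectation mu <<s G >> f h ->
  {ae mu, forall x, g x = h x}.
Proof.
move=> subG [/measurable_wrtP mg ig gE] [/measurable_wrtP mh ih hE].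
pose i (x : T) : g_sigma_algebraType G := x.
have mi : measurable_fun setT i by move=> _ E mE; rewrite setTI; exact: subG.
have mEg := (measurable_EFinP _ _).2 mg.
have mEh := (measurable_EFinP _ _).2 mh.
have := @integral_ae_eq _ (g_sigma_algebraType G) R (pushforward mu i) setT
  measurableT (EFin \o h) (EFin \o g) (integrable_pushforward mi mEg ig _) mEh.
move=> /(_ mi measurableT)[E _ mE|]; last first.
  move=> N [mN N0 subN]; exists N; split => //; first exact: subG.
  by move=> x /= gh; apply: subN => /= /(_ I)[].
rewrite [LHS]integral_pushforward//; last first.
  by apply: integrableS ig => //; exact: subG.
rewrite [RHS]integral_pushforward//; last first.
  by apply: integrableS ih => //; exact: subG.
by rewrite gE// hE.
Qed.

(** * Sigma-algebras of the branching process and of the spine *)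

Section filtrations.
Context {R : realType} {dJ dW : measure_display} {J : measurableType dJ}
  {W : measurableType dW} {Xi : W -> R -> J}.
Local Notation T := (spined_tree Xi).
Local Notation F t := (g_sigma_algebraType (branching_generators (Xi := Xi) t)).
Implicit Types (w : T) (u v : label) (s t : R) (E : set T).

(** The generators mention only the marked tree, and blindness to the spine is stable under
    complements and countable unions. *)
Lemma branching_filtration_mtree t E w w' :
  branching_filtration t E -> mtree w = mtree w' -> E w -> E w'.
Proof.
move=> FE; suff : [set E | forall w w', mtree w = mtree w' -> E w -> E w'] E.
  by apply.
move: FE; apply: smallest_sub; last first.
  move=> {}E [[[|]|]|].
  - by move=> [v [C [_ ->]]] {}w {}w' ww' /=; rewrite ww'.
  - by move=> [v [r [B [_ ->]]]] {}w {}w' ww' /=; rewrite ww'.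
  - by move=> [v ->] {}w {}w' ww' /=; rewrite ww'.
  - by move=> [v [r [B [_ ->]]]] {}w {}w' ww' /=; rewrite ww'.
split=> //.
- by move=> A AP {}w {}w' ww' [_ Aw]; split => //; apply: contra_not Aw; exact: AP.
- move=> A AP {}w {}w' ww' [n _ Aw]; exists n => //; exact: AP Aw.
Qed.

Lemma measurable_wrt_mtree t (f : T -> R) w w' :
  measurable_wrt (branching_filtration t) f -> mtree w = mtree w' -> f w = f w'.
Proof.
move=> mf ww'; have /= := branching_filtration_mtree (mf _ (measurable_set1 (f w))) ww'.
by move=> /(_ erefl).
Qed.

Lemma branching_filtration_sub t :
  branching_filtration (Xi := Xi) t `<=` spine_filtration t.
Proof. by move=> E FE; apply: sub_sigma_algebra; left. Qed.

Lemma spine_filtration_node t u :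
  spine_filtration t [set w : T | node t w = u].
Proof. by apply: sub_sigma_algebra; right; exists u. Qed.

(** The counterpart for events of the decomposition of [f] into the f_u: on {xi_t = u} an event
    about the node becomes trivial, and the sets with such a trace form a sigma-algebra. *)
Lemma spine_filtration_trace t u E : spine_filtration t E ->
  exists2 E', branching_filtration t E' &
    forall w, node t w = u -> E w <-> E' w.
Proof.
move: E; apply: smallest_sub; last first.
  move=> E [FE|[v ->]]; first by exists E.
  have [->|vu] := eqVneq u v.
    by exists setT => //; exact: (@measurableT _ (F t)).
  exists set0; first exact: (@measurable0 _ (F t)).
  by move=> w wu; split=> //= wv; move/eqP: vu; rewrite -wu wv.
split.
- by exists set0 => //; exact: (@measurable0 _ (F t)).
- move=> A [A' FA' AA']; exists (~` A'); first exact: (@measurableC _ (F t)).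
  by move=> w wu; split=> [[_ Aw]|A'w]; [|split => //]; move=> /(AA' w wu).
- move=> A AP; have /choice[A' A'P] : forall n, exists A',
      branching_filtration t A' /\ forall w, node t w = u -> A n w <-> A' w.
    by move=> n; have [A' FA' AA'] := AP n; exists A'.
  exists (\bigcup_n A' n).
    by apply: (@bigcupT_measurable _ (F t)) => n; exact: (A'P n).1.
  by move=> w wu; split=> -[n _ Anw]; exists n => //; apply/(A'P n).2.
Qed.

Lemma branching_filtration_alive t u :
  branching_filtration t [set w : T | alive w t u].
Proof. by apply: sub_sigma_algebra; left; right; exists u. Qed.

(** A particle born by time [t] is then either alive or dead, and each case is a generator. *)
Lemma branching_filtration_born t u :
  branching_filtration t [set w : T | tree w u /\ birth w u <= t].
Proof.
rewrite (_ : [set w : T | _] = [set w : T | alive w t u] `|`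
    [set w : T | [/\ tree w u, death w u <= t & setT (lifetime w u)]]).
  apply: (@measurableU _ (F t)); first exact: branching_filtration_alive.
  by apply: sub_sigma_algebra; do 3 left; exists u, setT.
apply/seteqP; split=> [w /= [tu bu]|w [[tu /andP[bu _]]|[tu du _]]].
- have [dt|td] := leP (death w u) t; first by right.
  by left; split; rewrite ?bu.
- by split.
- split => //; rewrite (le_trans _ du)// /birth gerBl ltW//.
  exact: spined_tree_lifetime.
Qed.

(** Offspring numbers are not recorded by the generators; that of a strict ancestor of a particle
    alive at [t] is read off its children born by time [t]. *)
Lemma measurable_offspring t u v : v \in ancestors u ->
  measurable_fun ([set w : T | alive w t u] : set (F t)) (fun w : T => offspring w v).
Proof.
move=> vu mD Y _.
(* The children of [v] are all born at the death of [v], no later than the birth of [u]; their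
   letters run from 0 to [offspring w v] inclusive. *)
have off w i : alive w t u ->
    (tree w (rcons v i) /\ birth w (rcons v i) <= t) <-> (i <= offspring w v)%N.
  move=> [tu /andP[bu _]]; rewrite birth_rcons.
  have tv : tree w v.
    by apply: tree_prefix tu; move: vu; rewrite mem_ancestors => /andP[].
  have [_ _ /(_ _ tv i) <-] := spined_tree_gw w.
  by split=> [[]//|tvi]; split => //; rewrite (le_trans _ bu)// death_le_birth.
(* The offspring number is [k] exactly when the child of letter [k] is born and that of letter
   [k.+1] is not. *)
rewrite (_ : _ `&` _ = \bigcup_(k in Y) ([set w : T | alive w t u] `&`
    ([set w : T | tree w (rcons v k) /\ birth w (rcons v k) <= t] `\`
     [set w : T | tree w (rcons v k.+1) /\ birth w (rcons v k.+1) <= t]))).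
  apply: bigcup_measurable => k _; apply: (@measurableI _ (F t)) => //.
  by apply: (@measurableD _ (F t)); exact: branching_filtration_born.
apply/seteqP; split=> [w [au Yw]|w [k Yk [au [/(off _ _ au)kv /(off _ _ au)]]]].
  exists (offspring w v) => //; split => //; split; first exact/off.
  by move=> /(off _ _ au); rewrite ltnn.
by move=> /negP; rewrite -leqNgt => vk; split => //=;
  rewrite (_ : offspring w v = k)//; apply/eqP; rewrite eqn_leq vk.
Qed.

(* The discount is an integral over time of a path of which the filtration only
   sees the values at fixed times: its measurability comes from that of
   zeta_tilde, by rerouting the spine through u. *)
Lemma measurable_alive_reroute t u (f g : T -> R) : 0 <= t ->
  measurable_wrt (spine_filtration t) f ->
  (forall w w', mtree w = mtree w' -> g w = g w') ->
  (forall w, node t w = u -> f w = g w) ->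
  measurable_fun ([set w : T | alive w t u] : set (F t)) g.
Proof.
move=> t0 mf g_mtree fg mD B mB.
have [E' FE' fE'] := spine_filtration_trace u (mf _ mB).
rewrite (_ : _ `&` _ = [set w : T | alive w t u] `&` E').
  exact: (@measurableI _ (F t)).
(* [E'] matches the preimage under [f] only on {xi_t = u}. Rerouting [w] through [u] leads into this
   event, and neither [E'] nor [g] distinguishes [w] from [w']. *)
apply/seteqP; split=> w [au] Bw; split => //;
  have [w' w'w w'u] := reroute_spine t0 au.
- apply: (branching_filtration_mtree FE' w'w); apply/(fE' _ w'u).
  by rewrite /= (fg _ w'u) (g_mtree _ _ w'w).
- move: Bw => /(branching_filtration_mtree FE' (esym w'w))/(fE' _ w'u).
  by rewrite /= (fg _ w'u) (g_mtree _ _ w'w).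
Qed.

Lemma node0 w : node 0 w = [::].
Proof. by apply/(alive0 w); exact: alive_node. Qed.

(** The spine starts at the root, and F_t records the path of the root at time 0 whether the root is
    dead or alive at [t]. This will make [zeta 0] measurable for F_t. *)
Lemma position_filtration0 t : 0 <= t ->
  position_filtration (Xi := Xi) 0 `<=` branching_filtration t.
Proof.
move=> t0; apply: smallest_sub; first exact: smallest_sigma_algebra.
move=> _ [s [B [/andP[s0 s0' mB ->]]]].
have {s0 s0'} -> : s = 0 by apply/eqP; rewrite eq_le s0 s0'.
have d0 w : 0 < death w [::].
  rewrite death_nil; apply: spined_tree_lifetime.
  by have [] := spined_tree_gw w.
rewrite (_ : _ @^-1` _ =
    [set w : T | [/\ tree w [::], death w [::] <= t,
       birth w [::] <= 0 < death w [::] & B (particle_path w [::] 0)]] `|`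
    [set w : T | [/\ alive w t [::], birth w [::] <= 0 <= t &
       B (particle_path w [::] 0)]]).
  apply: (@measurableU _ (F t)); apply: sub_sigma_algebra.
    by left; left; right; exists [::], 0, B.
  by right; exists [::], 0, B.
have posE w : spine_position 0 w = particle_path w [::] 0.
  by rewrite /spine_position extpath_node ?lexx// node0.
apply/seteqP; split=> [w|w []]; rewrite /= posE; [|by case|by case].
have tn : tree w [::] by have [] := spined_tree_gw w.
move=> Bw; rewrite birth_nil lexx d0 t0/=.
have [dt|td] := leP (death w [::]) t; [by left|right; split => //].
by split; rewrite // birth_nil t0.
Qed.

End filtrations.

(** * Sums over the living particles *)

Section alive_sum.
Context {R : realType} {dJ dW : measure_display} {J : measurableType dJ}
  {W : measurableType dW} {Xi : W -> R -> J}.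
Local Notation T := (spined_tree Xi).
Local Notation F t := (g_sigma_algebraType (branching_generators (Xi := Xi) t)).
Implicit Types (w : T) (u v : label) (s t : R) (E : set T).

(** The index set is random. With all labels enumerated through [pickle], the sum is a pointwise
    limit of sums over fixed indices, eventually constant because finitely many particles are
    alive. *)
Lemma measurable_alive_sum t (h : label -> T -> R) : 0 <= t ->
  (forall v, measurable_fun ([set w : T | alive w t v] : set (F t)) (h v)) ->
  measurable_fun setT (fun w : F t => \sum_(v \in alive (w : T) t) h v w).
Proof.
move=> t0 mh; pose H v : F t -> R := h v \_ [set w : T | alive w t v].
have mH v : measurable_fun setT (H v).
  apply/(measurable_restrictT _ _).1; last exact: mh.
  exact: branching_filtration_alive.
(* A number that encodes no label contributes 0. *)
pose K i (w : F t) := if (pickle_inv i : option label) is Some v then H v w else 0.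
apply: (@measurable_fun_cvg _ (F t) R _ (fun n w => \sum_(i < n) K i w)) => [n|w _].
  rewrite /K; apply: measurable_sum => i.
  by case: pickle_inv => [v|]; [exact: mH|exact: measurable_cst].
have /finite_seqP[r alive_r] := finite_alive (w : T) t0.
pose N := (\max_(v <- r) pickle v).+1.
apply: cvg_near_cst; near=> n.
have Nn : (N <= n)%N by near: n; exact: nbhs_infty_ge.
rewrite (@fsbig_ord _ _ _ n (K ^~ w)) -(@fsbig_widen _ _ _ _ (pickle @` alive (w : T) t)).
- rewrite fsbig_image; last by move=> v v' _ _; exact: (pcan_inj pickleK).
  by apply: eq_fsbigr => v av; rewrite /K pickleK_inv /H patchE mem_set//; exact/set_mem.
- move=> _ [v av <-] /=; rewrite (leq_trans _ Nn)// ltnS.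
  by apply: leq_bigmax_seq => //; move: av; rewrite alive_r.
- move=> i [_ nai] /=; rewrite /K; have := pickle_invK (T := label) i.
  case: pickle_inv => //= v vi; rewrite /H patchE memNset// => av.
  by apply: nai; exists v.
Unshelve. all: by end_near.
Qed.

(** The spine node is alive, so exactly its term of the sum survives. *)
Lemma spine_representationP t (f : T -> R) (f_ : label -> T -> R) : 0 <= t ->
  spine_representation t f f_ <->
  (forall u, measurable_wrt (branching_filtration (Xi := Xi) t) (f_ u)) /\
  forall w, f w = f_ (node t w) w.
Proof.
move=> t0.
have nodeE w : \sum_(u \in alive w t) f_ u w * (node t w == u)%:R = f_ (node t w) w.
  rewrite (fsbigE [:: node t w])//=.
  - by rewrite big_cons big_nil mem_set ?eqxx ?mulr1 ?addr0//; exact: alive_node.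
  - by move=> u /=; rewrite inE => /eqP ->; exact: alive_node.
  - by move=> u _; rewrite inE eq_sym => /negbTE ->; rewrite mulr0.
by split=> -[mf fE]; split => // w; rewrite fE nodeE.
Qed.

End alive_sum.

(** * The change of measure and the many-to-one formula *)

Section many_to_one.
Context {R : realType} {dJ dW : measure_display} {J : measurableType dJ}
  {W : measurableType dW} {Xi : W -> R -> J}.
Local Notation T := (spined_tree Xi).
Local Notation F t := (g_sigma_algebraType (branching_generators (Xi := Xi) t)).
Context (rate : J -> R) (A : R.-pker J ~> nat) (zeta : R -> T -> R)
  (zeta_ : label -> R -> T -> R).
Context (zeta_gt0 : forall t w, 0 <= t -> 0 < zeta t w).
Context (zeta_representation : forall t, 0 <= t ->
  spine_representation t (zeta t) (fun u => zeta_ u t)).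
Implicit Types (w : T) (u v : label) (s t : R) (E : set T).

Local Notation Zt := (zeta_tilde rate A zeta).
Local Notation Z := (Z rate A zeta_).

Definition fertility u w : R := \prod_(v <- ancestors u) (1 + offspring w v)%:R.

Definition mass t u w : R := discount rate A t u w * zeta_ u t w.

(** The right-hand side of the theorem. Sign and measurability of [mass t u] are established only
    where [u] is alive, the set that the indicator selects. *)
Definition share t u w : R :=
  \1_[set w' : T | alive w' t u] w * (mass t u w / Z t w).

Lemma fertility_gt0 u w : 0 < fertility u w.
Proof. by apply: prodr_gt0 => v _; rewrite ltr0n. Qed.

Lemma zeta_mtree t u w w' : 0 <= t -> mtree w = mtree w' ->
  zeta_ u t w = zeta_ u t w'.
Proof.
move=> t0; have [+ _] := zeta_representation t0.
by move=> /(_ u)/measurable_wrt_mtree; apply.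
Qed.

Lemma zeta_node t w : 0 <= t -> zeta t w = zeta_ (node t w) t w.
Proof.
move=> t0.
by have [_] := (spine_representationP _ _ t0).1 (zeta_representation t0).
Qed.

(** [zeta_gt0] bears on [zeta_ u] only where [u] is the spine node. As [zeta_ u t] does not see the
    spine, rerouting extends positivity to every tree in which [u] is alive. *)
Lemma mass_gt0 t u w : 0 <= t -> alive w t u -> 0 < mass t u w.
Proof.
move=> t0 au; rewrite /mass mulr_gt0 ?expR_gt0//.
have [w' w'w w'u] := reroute_spine t0 au.
by rewrite -(zeta_mtree u t0 w'w) -[in zeta_ u]w'u -zeta_node ?zeta_gt0.
Qed.

(** Up to [t] the spine follows the extended path of its node at [t], so the exponent is that of
    [discount] at this node. *)
Lemma zeta_tilde_node t w : 0 <= t ->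
  Zt t w = fertility (node t w) w * mass t (node t w) w.
Proof.
move=> t0; rewrite /Zt /zeta_tilde /mass /discount /fertility zeta_node// mulrA.
apply: (congr1 (fun i : R => _ * expR (- i) * _)); apply: eq_Rintegral => s.
rewrite inE/= in_itv/= => /andP[s0 st].
by rewrite /spine_position !extpath_node ?s0 ?lexx.
Qed.

Lemma zeta_tilde0 w : Zt 0 w = zeta 0 w.
Proof.
by rewrite /Zt /zeta_tilde node0 big_nil mul1r set_itv1 Rintegral_set1 oppr0
  expR0 mul1r.
Qed.

Lemma zeta_tilde_gt0 t w : 0 <= t -> 0 < Zt t w.
Proof.
by move=> t0; rewrite zeta_tilde_node// mulr_gt0 ?fertility_gt0// mass_gt0//; exact: alive_node.
Qed.

Lemma measurable_fertility t u :
  measurable_fun ([set w : T | alive w t u] : set (F t)) (fertility u).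
Proof.
apply: measurable_prod => v vu.
apply: (@measurableT_comp _ _ _ _ _ _ (fun n : nat => (1 + n)%:R : R)) => //.
exact: measurable_offspring.
Qed.

Lemma measurable_fertility_mass t u : 0 <= t ->
  measurable_wrt (spine_filtration t) (Zt t) ->
  measurable_fun ([set w : T | alive w t u] : set (F t))
    (fun w : T => fertility u w * mass t u w).
Proof.
move=> t0 mZt; apply: (measurable_alive_reroute t0 mZt) => [w w' ww'|w <-].
  by rewrite /fertility /mass /discount ww' (zeta_mtree u t0 ww').
exact: zeta_tilde_node.
Qed.

(** Rerouting only reaches the product with the fertility, which is the form of [zeta_tilde] at [u];
    the fertility, positive and measurable by itself, is then divided out. *)
Lemma measurable_mass t u : 0 <= t ->
  measurable_wrt (spine_filtration t) (Zt t) ->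
  measurable_fun ([set w : T | alive w t u] : set (F t)) (mass t u).
Proof.
move=> t0 mZt.
apply: (@eq_measurable_fun _ _ (F t) R _
  (fun w : T => fertility u w * mass t u w * (fertility u w)^-1)).
  by move=> w _; rewrite mulrAC divff ?mul1r// gt_eqF// fertility_gt0.
apply: measurable_funM; first exact: measurable_fertility_mass.
by apply: measurable_funV_gt0; [move=> *; exact: fertility_gt0|exact: measurable_fertility].
Qed.

(** All terms of [Z] are positive. Both [Z > 0] and [share <= 1] follow from this bound. *)
Lemma mass_le_Z t u w : 0 <= t -> alive w t u -> mass t u w <= Z t w.
Proof.
move=> t0 au; rewrite /Defs.Z (fsbigD1 u)//=; last exact: finite_alive.
by rewrite lerDl; apply: fsumr_ge0 => v [av _]; apply/ltW/mass_gt0.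
Qed.

Lemma Z_gt0 t w : 0 <= t -> 0 < Z t w.
Proof.
move=> t0; have an := alive_node w t0.
exact: lt_le_trans (mass_gt0 t0 an) (mass_le_Z t0 an).
Qed.

Lemma measurable_Z t : 0 <= t ->
  measurable_wrt (spine_filtration t) (Zt t) ->
  measurable_wrt (branching_filtration t) (Z t).
Proof.
move=> t0 mZt; apply/measurable_wrtP; apply: measurable_alive_sum => // v.
exact: measurable_mass.
Qed.

Lemma share_ge0 t u w : 0 <= t -> 0 <= share t u w.
Proof.
move=> t0; rewrite /share indicE; have [au|] := boolP (w \in _); last first.
  by rewrite mul0r.
by rewrite mul1r divr_ge0// ltW ?Z_gt0// mass_gt0//; move: au; rewrite inE.
Qed.

Lemma share_le1 t u w : 0 <= t -> share t u w <= 1.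
Proof.
move=> t0; rewrite /share indicE; have [au|] := boolP (w \in _); last first.
  by rewrite mul0r.
rewrite mul1r ler_pdivrMr ?Z_gt0// mul1r mass_le_Z//.
by move: au; rewrite inE.
Qed.

Lemma measurable_share t u : 0 <= t ->
  measurable_wrt (spine_filtration t) (Zt t) ->
  measurable_wrt (branching_filtration t) (share t u).
Proof.
move=> t0 mZt; apply/measurable_wrtP.
rewrite (_ : share t u = (fun w : T =>
    (mass t u \_ [set w : T | alive w t u]) w * (Z t w)^-1)); last first.
  apply/funext => w; rewrite /share patchE indicE.
  by case: (w \in _); rewrite ?mul1r// !mul0r.
apply: measurable_funM.
  apply/(measurable_restrictT _ _).1; last exact: measurable_mass.
  exact: branching_filtration_alive.
apply: measurable_funV_gt0 => [w _|]; first exact: Z_gt0.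
by apply/measurable_wrtP; exact: measurable_Z.
Qed.

(** The density brings in zeta_tilde(t) / zeta(0), whose fertility factor cancels against the
    weights in the definition of Ptilde. *)
Lemma integral_changed_measure (P : probability (branching_space Xi) R)
    (Pt Q : probability (spine_space Xi) R) t (f : T -> R)
    (f_ : label -> T -> R) :
  spine_measure P Pt -> changed_measure Pt Q Zt ->
  measurable_wrt (position_filtration (Xi := Xi) 0) (zeta 0) ->
  measurable_wrt (spine_filtration t) (Zt t) ->
  0 <= t -> measurable_wrt (spine_filtration t) f -> (forall w, 0 <= f w) ->
  spine_representation t f f_ ->
  (\int[Q]_w (f w)%:E =
   \int[P]_w (\sum_(u \in alive w t) f_ u w * mass t u w / zeta 0 w)%R%:E)%E.
Proof.
move=> PtE QE mz0 mZt t0 mf f0 /(spine_representationP _ _ t0)[mf_ fE].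
have subS : spine_filtration (Xi := Xi) t `<=`
    (@measurable _ (spine_space Xi) : set (set (spine_space Xi))).
  by move=> E SE; apply: sub_sigma_algebra; exists t.
(* Each coefficient of the representation stays F_t-measurable after division by [zeta 0]. *)
have mz0V : measurable_wrt (branching_filtration (Xi := Xi) t) (fun w => (zeta 0 w)^-1).
  apply/measurable_wrtP; apply: measurable_funV_gt0 => [w _|]; first exact: zeta_gt0.
  by apply/measurable_wrtP => B mB; apply: (position_filtration0 t0); exact: mz0.
pose D w := Zt t w / Zt 0 w.
have D0 w : 0 <= D w by rewrite divr_ge0// ltW// zeta_tilde_gt0.
have mD : measurable_wrt (spine_filtration (Xi := Xi) t) D.
  apply/measurable_wrtP; apply: measurable_funM; first exact/measurable_wrtP.
  rewrite (_ : (fun w => _) = (fun w : T => (zeta 0 w)^-1)); last first.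
    by apply/funext => w; rewrite zeta_tilde0.
  by apply/measurable_wrtP => B mB; apply: branching_filtration_sub; exact: mz0V.
rewrite (@ge0_integral_density_wrt _ _ (spine_space Xi) Pt Q _ D f subS)//; last first.
  by move=> E; exact: QE.
(* The cut to the trees where [u] is alive makes [k u] measurable for F_t on the whole space;
   neither the sum over N_t nor the value at the spine node sees it. *)
pose k u := (fun w : T => fertility u w * mass t u w) \_ [set w : T | alive w t u].
rewrite (PtE t _ (fun u w => f_ u w * (k u w / zeta 0 w)))//.
- apply: eq_integral => w _; congr (_%:E); apply: eq_fsbigr => u /set_mem au.
  rewrite /k patchE mem_set// prodfV -/(fertility u w).
  have mulKr_div (a b c d : R) : b != 0 -> a * (b * c / d) / b = a * c / d.
    by move=> b0; rewrite mulrC !mulrA [_ * a * b]mulrAC mulVf// mul1r.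
  by rewrite mulKr_div// gt_eqF// fertility_gt0.
- apply/measurable_wrtP; apply: measurable_funM; exact/measurable_wrtP.
- by left => w; rewrite mulr_ge0.
apply/spine_representationP => //; split=> [u|w].
  apply/measurable_wrtP; apply: measurable_funM; first exact/measurable_wrtP.
  apply: measurable_funM; last exact/measurable_wrtP.
  apply/(measurable_restrictT _ _).1; last exact: measurable_fertility_mass.
  exact: branching_filtration_alive.
rewrite /= fE /D zeta_tilde0 zeta_tilde_node// /k patchE mem_set//.
exact: alive_node.
Qed.

Lemma share_cond_probability (P : probability (branching_space Xi) R)
    (Pt Q : probability (spine_space Xi) R) t u :
  spine_measure P Pt -> changed_measure Pt Q Zt ->
  measurable_wrt (position_filtration (Xi := Xi) 0) (zeta 0) ->
  measurable_wrt (spine_filtration t) (Zt t) ->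
  0 <= t ->
  is_cond_probability Q (branching_filtration t) [set w : T | node t w = u]
    (share t u).
Proof.
move=> PtE QE mz0 mZt t0; have mS := measurable_share u t0 mZt.
have subQ : branching_filtration (Xi := Xi) t `<=`
    (@measurable _ (spine_space Xi) : set (set (spine_space Xi))).
  move=> E FE; apply: sub_sigma_algebra; exists t => //.
  exact: branching_filtration_sub.
split=> // [|E FE].
  apply: (@measurable_bounded_integrable _ (spine_space Xi)) => //.
  - by rewrite (le_lt_trans (probability_le1 _ _))// ltry.
  - by move=> _ B mB; rewrite setTI; apply: subQ; exact: mS.
  - exists 1; split; first exact: num_real.
    move=> c c1 w _ /=; rewrite ger0_norm ?share_ge0//.
    by rewrite (le_trans (share_le1 u w t0))// ltW.
have mE1 : measurable_wrt (branching_filtration (Xi := Xi) t) (\1_E : T -> R).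
  by apply/measurable_wrtP; exact: (@measurable_indic _ (F t)).
have integral1E (g : T -> R) :
    (\int[Q]_(w in E) (g w)%:E = \int[Q]_w (\1_E w * g w)%:E)%E.
  rewrite integral_mkcond; apply: eq_integral => w _.
  by rewrite patchE indicE; case: (w \in E); rewrite ?mul1r ?mul0r.
have spine1E : measurable_wrt (spine_filtration (Xi := Xi) t) (\1_E : T -> R).
  by move=> B mB; apply: branching_filtration_sub; exact: mE1.
have change := integral_changed_measure PtE QE mz0 mZt t0.
(* An F_t-measurable function is represented by the same coefficient at every label. *)
rewrite !integral1E (change _ (fun=> fun w => \1_E w * share t u w)).
(* The indicator of {xi_t = u} has coefficient 1 at [u] and 0 at the other labels. *)
- rewrite (change _ (fun v w => \1_E w * (v == u)%:R)).
  + apply: eq_integral => w _; congr (_%:E).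
    (* Both sums are divided by [zeta 0]. On the left the masses add up to [Z], which cancels the
       denominator of [share]; on the right only the term of [u] is left, present exactly when [u]
       is alive. *)
    rewrite -mulr_fsuml -[RHS]mulr_fsuml; congr (_ / _).
    rewrite -mulr_fsumr -/(Z t w).
    rewrite /share -2!mulrA divfK ?gt_eqF ?Z_gt0//.
    under eq_fsbigr => v _ do rewrite -mulrA.
    rewrite -mulr_fsumr; congr (_ * _).
    have [au|nau] := pselect (alive w t u).
      rewrite indicE mem_set// mul1r (fsbigD1 u)//=; last exact: finite_alive.
      rewrite eqxx mul1r fsbig1 ?addr0// => v [_ /eqP/negbTE ->].
      by rewrite mul0r.
    rewrite indicE memNset// mul0r fsbig1// => v av; have [vu|_] := eqVneq v u; last first.
      by rewrite mul0r.
    by case: nau; rewrite -vu.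
  + apply/measurable_wrtP; apply: measurable_funM; first exact/measurable_wrtP.
    apply: measurable_indic; exact: spine_filtration_node.
  + by move=> w; rewrite mulr_ge0.
  + apply/spine_representationP => //; split => [v|w].
      by apply/measurable_wrtP; apply: measurable_funM; [exact/measurable_wrtP|].
    rewrite indicE; congr (_ * (nat_of_bool _)%:R).
    by apply/idP/eqP => [/set_mem|/mem_set].
- apply/measurable_wrtP; apply: measurable_funM; first exact/measurable_wrtP.
  by apply/measurable_wrtP => B mB; apply: branching_filtration_sub; exact: mS.
- by move=> w; rewrite mulr_ge0// share_ge0.
- apply/spine_representationP => //; split => // v.
  by apply/measurable_wrtP; apply: measurable_funM; exact/measurable_wrtP.
Qed.

End many_to_one.

(** * Conditional law of the spine node given the branching process *)

Theorem theorem8p1 (R : realType) (dJ dW : measure_display)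
    (J : measurableType dJ) (W : measurableType dW)
    (Px : R.-pker J ~> W) (Xi : W -> R -> J)
    (rate : J -> R) (A : R.-pker J ~> nat) (x : J)
    (P : probability (branching_space Xi) R)
    (Pt Q : probability (spine_space Xi) R)
    (zeta : R -> spined_tree Xi -> R)
    (zeta_ : label -> R -> spined_tree Xi -> R)
    (markov_Xi : markov_process Px Xi)
    (measurable_rate : measurable_fun setT rate)
    (rate_ge0 : forall y, 0 <= rate y)
    (finite_mean : forall y, (offspring_mean A y < +oo)%E)
    (finite_integrals : forall (t : R) (w : spined_tree Xi) (u : label),
       0 <= t -> alive w t u ->
       (@lebesgue_measure R).-integrable `[0, t]
         (fun s => (m A (extpath w u s) * rate (extpath w u s))%:E))
    (law_P : branching_markov_law Px rate A x P)
    (law_Pt : spine_measure P Pt)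
    (zeta_gt0 : forall t w, 0 <= t -> 0 < zeta t w)
    (zeta_martingale : martingale Pt (position_filtration (Xi := Xi)) zeta)
    (zeta_representation : forall t, 0 <= t ->
       spine_representation t (zeta t) (fun u => zeta_ u t))
    (zeta_tilde_martingale :
       martingale Pt (spine_filtration (Xi := Xi)) (zeta_tilde rate A zeta))
    (law_Q : changed_measure Pt Q (zeta_tilde rate A zeta))
    (u : label) (t : R) (t_ge0 : 0 <= t) :
  let rhs (w : spined_tree Xi) : R :=
    \1_[set w' : spined_tree Xi | alive w' t u] w
    * (discount rate A t u w * zeta_ u t w / Z rate A zeta_ t w) in
  is_cond_probability Q (branching_filtration t)
    [set w : spined_tree Xi | node t w = u] rhs /\
  forall g : spined_tree Xi -> R,
    is_cond_probability Q (branching_filtration t)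
      [set w : spined_tree Xi | node t w = u] g ->
    {ae Q, forall w, g w = rhs w}.
Proof.
have [mzeta _ _] := zeta_martingale.
have [mzeta_tilde _ _] := zeta_tilde_martingale.
move=> rhs; have rhsP : is_cond_probability Q (branching_filtration t)
    [set w : spined_tree Xi | node t w = u] rhs.
  exact: (share_cond_probability zeta_gt0 zeta_representation u law_Pt law_Q
    (mzeta 0 (lexx 0)) (mzeta_tilde t t_ge0) t_ge0).
(* F_t lies in the sigma-algebra on which [Q] is defined, so any two versions agree almost
   surely. *)
split=> // g gP; apply: (cond_expectation_unique _ gP rhsP) => E FE.
by apply: sub_sigma_algebra; exists t => //; exact: branching_filtration_sub.
Qed.
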